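(* Let $n>2$ be an integer and let $m\neq 0,\pm1$ be a square-free integer. Let $\vartheta=\sqrt[n]{m}$ and $K=\mathbb{Q}(\vartheta)$. Suppose that $(1,\vartheta,\ldots,\vartheta^{n-1})$ is not an integral basis of $K$. Then for any element \[ \alpha=\frac{a_0+a_1\vartheta+\cdots+a_{n-1}\vartheta^{n-1}}{q} \] of an integral basis of $K$ (with $a_0,\ldots,a_{n-1},q\in\mathbb{Z}$, $q>0$, and $\gcd(a_0,\ldots,a_{n-1},q)=1$), the denominator $q$ is divisible only by primes dividing $n$, and no prime factor of $q$ divides $m$.
   Context: An integral basis of $K$ is a $\mathbb{Z}$-basis of the ring of integers $\mathbb{Z}_K$ of $K$. *)

(* Defs.v *)
From mathcomp Require Import all_boot all_order all_algebra all_field.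

Set Implicit Arguments.
Unset Strict Implicit.
Unset Printing Implicit Defensive.

Import GRing.Theory.
Local Open Scope ring_scope.

Definition squarefree_int (m : int) : Prop :=
  forall d : int, (d ^+ 2 %| m)%Z -> d \is a GRing.unit.

Definition in_ring_of_integers (K : fieldExtType rat) (x : K) : Prop :=
  integralOver (intr : int -> K) x.

Definition integral_basis (K : fieldExtType rat) (k : nat)
    (b : k.-tuple K) : Prop :=
  [/\ forall i : 'I_k, in_ring_of_integers (tnth b i),
      forall c : 'I_k -> int,
        \sum_(i < k) (c i)%:~R * tnth b i = 0 -> forall i, c i = 0
    & forall x : K, in_ring_of_integers x ->
        exists c : 'I_k -> int, x = \sum_(i < k) (c i)%:~R * tnth b i].

(* Main.v *)
(** Suppose [p] divides [q] and put [beta = alpha q / p], an algebraic integer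
    with [p beta = g(theta)], where [g = sum a_i X^i] is not zero mod [p].

    If [p | m], let [a_j] be the first coefficient prime to [p].  Multiplying by
    [theta^(n-1-j)] leaves [a_j theta^(n-1)] as the only term not visibly in
    [p Z_K]; its [n]-th power is [a_j^n m^(n-1)], which [p^n] does not divide
    because [m] is square-free.  The same argument at a prime factor of [m],
    applied to [beta = 0], shows that [1, theta, ..., theta^(n-1)] are linearly
    independent.

    If [p] divides neither [m] nor [n], clearing denominators in a monic
    equation of [beta] shows that a power of [g] lies in [(p, X^n - m)].  As
    [X^n - m] is separable mod [p] and [deg g < n], [g] is zero mod [p]. *)

Require Import Defs.
From mathcomp Require Import all_boot all_order all_algebra all_field.

Import GRing.Theory.
Local Open Scope ring_scope.

Local Notation ev x g := (map_poly intr g).[x].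

(** * Divisibility in the integers *)

Lemma dvdz_primeM (p : nat) (x y : int) : prime p ->
  (p %| x * y)%Z = (p %| x)%Z || (p %| y)%Z.
Proof. by move=> p_pr; rewrite !dvdzE abszM Euclid_dvdM. Qed.

Lemma dvdz_primeX (p : nat) (x : int) d : prime p ->
  (p %| x ^+ d)%Z -> (p %| x)%Z.
Proof. by move=> p_pr; rewrite !dvdzE abszX Euclid_dvdX // => /andP[]. Qed.

Lemma dvdz_big_gcdz (n : nat) (a : 'I_n -> int) (d q : int) :
  (d %| q)%Z -> (forall i, (d %| a i)%Z) -> (d %| \big[gcdz/q]_(i < n) a i)%Z.
Proof.
by move=> dq da; elim/big_ind: _ => // x y dx dy; rewrite dvdz_gcd dx.
Qed.

(** * Separable polynomials over a field *)

Lemma separable_dvdp_exp (F : fieldType) (f g : {poly F}) d :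
  separable_poly f -> f %| g ^+ d -> f %| g.
Proof.
move=> sep_f f_gd; set h := gcdp f g.
have Ef : f = (f %/ h) * h by rewrite divpK ?dvdp_gcdl.
have f1f : f %/ h %| f by rewrite {2}Ef dvdp_mulr.
(* Separability makes [f %/ h] coprime to [h], hence to [g], as a common divisor with [g] divides
   [h]. Being also a divisor of [g ^+ d], it is a unit. *)
have co_h : coprimep (f %/ h) h.
  by move: sep_f; rewrite {1}Ef separable_mul => /and3P[].
have co_g : coprimep (f %/ h) g.
  apply/coprimepP => e e_f1 e_g.
  by move/coprimepP: co_h; apply; rewrite // dvdp_gcd e_g (dvdp_trans e_f1).
have: f %/ h %| 1.
  rewrite -(Gauss_dvdpr _ (coprimep_expr d co_g)) mulr1.
  exact: dvdp_trans f_gd.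
move=> f1_1; rewrite Ef; apply: dvdp_trans (dvdp_gcdr f g).
by rewrite -/h -{3}[h]mul1r dvdp_mul.
Qed.

Lemma separable_XnsubC (F : fieldType) n (c : F) :
  (0 < n)%N -> n%:R != 0 :> F -> c != 0 -> separable_poly ('X^n - c%:P).
Proof.
case: n => // n _ n_neq0 c_neq0.
rewrite unlock; apply/Bezout_coprimepP.
(* With [N] the exponent and [f = X^N - c], [X f' - N f] is the nonzero constant [N c]. *)
exists (- (n.+1%:R)%:P, 'X) => /=.
suff -> : - (n.+1%:R)%:P * ('X^(n.+1) - c%:P) + 'X * ('X^(n.+1) - c%:P)^`() =
    (n.+1%:R * c)%:P by rewrite polyC_eqp1 mulf_neq0.
rewrite derivB derivXn derivC subr0 /= mulrnAr -exprS polyCM polyC_natr.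
by rewrite mulrBr !mulNr opprK mulr_natl addrAC addNr add0r.
Qed.

(** * Algebraic integers and divisibility by a rational integer *)

Section IntegersOfNumberField.

Variable K : fieldExtType rat.
Implicit Types (x y : K) (g h : {poly int}).

Lemma fieldExt_intr_inj : injective (intr : int -> K).
Proof.
move=> x y; rewrite -!(rmorph_int (GRing.in_alg K)).
by move/fmorph_inj/intr_inj.
Qed.

Lemma fieldExt_intr_eq0 (z : int) : (z%:~R == 0 :> K) = (z == 0).
Proof. by rewrite -(inj_eq fieldExt_intr_inj). Qed.

Lemma integral_intr (z : int) : in_ring_of_integers (z%:~R : K).
Proof. exact: (integral_id (intr : {rmorphism int -> K})). Qed.

Lemma integral_exp x d : in_ring_of_integers x -> in_ring_of_integers (x ^+ d).
Proof.
move=> x_int; elim: d => [|d IHd]; first exact: (integral_intr 1).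
by rewrite exprS; apply: (integral_mul (RtoK := intr)).
Qed.

(* Clearing denominators in a monic equation of [x]. *)
Lemma integral_scaled_exp (p : int) x : in_ring_of_integers x ->
  exists d h, (p%:~R * x) ^+ d = p%:~R * ev (p%:~R * x) h.
Proof.
case=> P P_mon /rootP Px0; pose d := (size P).-1.
have sP : size P = d.+1 by rewrite /d prednK // size_poly_gt0 monic_neq0.
(* Multiplying the equation by [p ^+ d] gives the term in [x ^+ i] a factor [p ^+ (d - i)] beyond
   [(p x) ^+ i]; as [i < d], one [p] comes out. *)
exists d, (- \poly_(i < d) (P`_i * p ^+ (d - i).-1)).
have Exd : x ^+ d = - \sum_(i < d) (P`_i)%:~R * x ^+ i.
  apply/eqP; rewrite -addr_eq0 addrC; apply/eqP.
  rewrite -[RHS]Px0 (@horner_coef_wide _ d.+1) ?size_map_poly ?sP //.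
    rewrite big_ord_recr /= coef_map /= -[P`_d]/(P`_(size P).-1).
    rewrite -/(lead_coef P) (monicP P_mon) mul1r.
    by congr (_ + _); apply: eq_bigr => i _; rewrite coef_map.
  by rewrite -sP size_poly.
rewrite rmorphN hornerN mulrN (@horner_coef_wide _ d); last first.
  by apply: leq_trans (size_poly _ _) _; rewrite size_poly.
rewrite exprMn Exd mulrN !mulr_sumr; congr (- _); apply: eq_bigr => i _.
rewrite coef_map coef_poly ltn_ord /= rmorphM rmorphXn /= exprMn.
have -> : p%:~R ^+ d = p%:~R * p%:~R ^+ (d - i).-1 * p%:~R ^+ i :> K.
  by rewrite -exprS prednK ?subn_gt0 // -exprD subnK // ltnW.
rewrite -!mulrA; congr (_ * _); rewrite [RHS]mulrCA; congr (_ * _).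
by rewrite mulrCA.
Qed.

Lemma ev_intr (z : int) h : ev (z%:~R : K) h = (h.[z])%:~R.
Proof. by rewrite horner_map. Qed.

(** The scaled equation of [x] reads [z ^+ d = p * h.[z]], an identity between rational integers. *)
Lemma dvdz_integral (p : nat) (z : int) x : prime p ->
  in_ring_of_integers x -> z%:~R = p%:~R * x -> (p %| z)%Z.
Proof.
move=> p_pr x_int Ez; have [d [h]] := integral_scaled_exp p x x_int.
rewrite -Ez ev_intr -rmorphXn -rmorphM => /fieldExt_intr_inj Ezd.
by apply: (@dvdz_primeX _ _ d p_pr); rewrite Ezd dvdz_mulr.
Qed.

Definition in_pO (p : int) x :=
  exists2 y, in_ring_of_integers y & x = p%:~R * y.

Lemma in_pO_add p x y : in_pO p x -> in_pO p y -> in_pO p (x + y).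
Proof.
move=> [u u_int ->] [v v_int ->]; exists (u + v); last by rewrite mulrDr.
exact: (integral_add (RtoK := intr)).
Qed.

Lemma in_pO_mulr p x y : in_ring_of_integers y -> in_pO p x -> in_pO p (x * y).
Proof.
move=> y_int [u u_int ->]; exists (u * y); last by rewrite mulrA.
exact: (integral_mul (RtoK := intr)).
Qed.

Lemma in_pO_intr (p z : int) : (p %| z)%Z -> in_pO p (z%:~R).
Proof.
case/dvdzP => c ->; exists (c%:~R); first exact: integral_intr.
by rewrite mulrC rmorphM.
Qed.

(** * Integer polynomials in [theta] with value in [p Z_K] *)

Section Radical.

Variables (n : nat) (m : int) (theta : K).
Hypotheses (n_gt0 : (0 < n)%N) (theta_root : theta ^+ n = m%:~R).

Lemma theta_integral : in_ring_of_integers theta.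
Proof.
exists ('X^n - m%:P); first exact: monicXnsubC.
apply/rootP; rewrite rmorphB /= map_polyXn map_polyC /= !hornerE.
by rewrite theta_root subrr.
Qed.

Lemma eisenstein_coef_dvd (p : nat) g : prime p ->
    (p %| m)%Z -> ~~ ((p : int) ^+ 2 %| m)%Z -> (size g <= n)%N ->
    in_pO p (ev theta g) -> forall j, (p %| g`_j)%Z.
Proof.
move=> p_pr pm p2m sg pg.
elim/ltn_ind => j IHj.
have [nj | jn] := leqP n j; first by rewrite nth_default ?dvdz0 ?(leq_trans sg).
have: in_pO p ((g`_j)%:~R * theta ^+ n.-1).
  have Eg : ev theta g * theta ^+ (n.-1 - j) =
      \sum_(i < n) (g`_i)%:~R * theta ^+ (i + (n.-1 - j)).
    rewrite (@horner_coef_wide _ n) ?(leq_trans (size_poly _ _)) //.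
    rewrite mulr_suml; apply: eq_bigr => i _.
    by rewrite coef_map /= exprD mulrA.
  move: Eg; rewrite (bigD1 (Ordinal jn)) //= subnKC; last first.
    by rewrite -ltnS prednK.
  move/eqP; rewrite -subr_eq => /eqP <-.
  apply: in_pO_add.
    by apply: in_pO_mulr pg; apply/integral_exp/theta_integral.
  rewrite -mulN1r mulrC; apply: in_pO_mulr; first exact: (integral_intr (-1)).
  elim/big_ind: _ => [||i]; first exact: (in_pO_intr p 0).
    exact: in_pO_add.
  (* For [i < j] the factor [p] is in the coefficient, by induction; for [i > j] the exponent
     reaches [n], and [theta ^+ n = m] supplies it. *)
  rewrite -val_eqE /= neq_ltn => /orP[ij | ji].
    apply: in_pO_mulr; first exact/integral_exp/theta_integral.
    exact/in_pO_intr/IHj.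
  have -> : (i + (n.-1 - j) = n + (i - j.+1))%N.
    by rewrite -subn1 -subnDA add1n !addnBA // addnC.
  rewrite exprD theta_root mulrCA; apply: in_pO_mulr; last exact: in_pO_intr.
  apply: (integral_mul (RtoK := intr)); first exact: integral_intr.
  exact/integral_exp/theta_integral.
case=> y y_int Ey; have [m' Em] := dvdzP pm.
have pm' : ~~ (p %| m')%Z.
  apply: contra p2m; rewrite {1}Em expr2 => /dvdzP[m'' ->].
  by rewrite -mulrA dvdz_mull.
have p_neq0 : (p : int)%:~R != 0 :> K.
  by rewrite fieldExt_intr_eq0 eqz_nat -lt0n prime_gt0.
(* The [n]-th power of [Ey], with [m = m' * p], after cancelling [p ^+ n.-1]: one factor [p] remains
   on the right. *)
have: (p %| g`_j ^+ n * m' ^+ n.-1)%Z.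
  apply: (@dvdz_integral _ _ (y ^+ n) p_pr); first exact: integral_exp.
  apply: (mulIf (expf_neq0 n.-1 p_neq0)).
  rewrite mulrAC -exprS prednK // -exprMn -Ey exprMn exprAC theta_root Em.
  by rewrite !rmorphM !rmorphXn /= exprMn mulrA.
rewrite dvdz_primeM // => /orP[] /(dvdz_primeX _ _ _ p_pr) //.
by rewrite (negPf pm').
Qed.

(** The primitive part of a nonzero relation would also vanish at [theta], so [p] would divide all
    its coefficients. *)
Lemma eisenstein_linear_independence (p : nat) g : prime p ->
    (p %| m)%Z -> ~~ ((p : int) ^+ 2 %| m)%Z -> (size g <= n)%N ->
    ev theta g = 0 -> g = 0.
Proof.
move=> p_pr pm p2m sg g0; apply/eqP/negPn/negP => g_neq0.
have c_neq0 : zcontents g != 0 by rewrite zcontents_eq0.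
have sg' : (size (zprimitive g) <= n)%N by rewrite size_zprimitive.
have g'0 : ev theta (zprimitive g) = 0.
  move: g0; rewrite {1}(zpolyEprim g) linearZ /= hornerZ => /eqP.
  by rewrite mulf_eq0 fieldExt_intr_eq0 (negPf c_neq0) => /eqP.
have := eisenstein_coef_dvd _ _ p_pr pm p2m sg'.
rewrite g'0 => /(_ (in_pO_intr p 0 (dvdz0 _))) /polyOverP.
by rewrite -dvdz_contents zcontents_primitive g_neq0 dvdzE Euclid_dvd1.
Qed.

Lemma unramified_coef_dvd (p : nat) g : prime p ->
    ~~ (p %| n)%N -> ~~ (p %| m)%Z ->
    (forall h, (size h <= n)%N -> ev theta h = 0 -> h = 0) ->
    (size g <= n)%N -> in_pO p (ev theta g) -> forall j, (p %| g`_j)%Z.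
Proof.
move=> p_pr pn pm indep sg [y y_int Ey] j.
have pF := pchar_Fp p_pr.
pose f : {poly int} := 'X^n - m%:P.
have f_mon : f \is monic by exact: monicXnsubC.
have [d [h]] := integral_scaled_exp p y y_int.
rewrite -Ey => Egd.
pose r := g ^+ d - p%:Z *: (h \Po g).
have r0 : ev theta r = 0.
  rewrite rmorphB rmorphXn /= map_polyZ map_comp_poly.
  by rewrite !hornerE horner_comp Egd subrr.
have f0 : ev theta f = 0.
  by rewrite rmorphB /= map_polyXn map_polyC /= !hornerE theta_root subrr.
(* The remainder of [r] modulo the monic [f] has degree below [n] and vanishes at [theta], so
   independence kills it. *)
have Er : r = Pdiv.Ring.rdivp r f * f.
  rewrite {1}(Pdiv.RingMonic.rdivp_eq f_mon r) [X in _ + X]indep ?addr0 //.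
    by rewrite -ltnS -(size_XnsubC m n_gt0) Pdiv.Ring.ltn_rmodpN0 ?monic_neq0.
  move: r0; rewrite {1}(Pdiv.RingMonic.rdivp_eq f_mon r) rmorphD rmorphM /=.
  by rewrite !hornerE f0 mulr0 add0r.
pose toF := map_poly (intr : int -> 'F_p).
have toFf : toF f = 'X^n - (m%:~R)%:P.
  by rewrite /toF rmorphB /= map_polyXn map_polyC.
have f_sep : separable_poly (toF f).
  rewrite toFf; apply: separable_XnsubC => //.
    by rewrite -(dvdn_pcharf pF).
  by rewrite -(dvdz_pcharf pF).
have f_g : toF f %| toF g.
  apply: (@separable_dvdp_exp _ _ _ d f_sep).
  have -> : toF g ^+ d = toF r.
    rewrite /toF /r rmorphB rmorphXn /= map_polyZ /=.
    have /eqP -> : (p%:Z)%:~R == 0 :> 'F_p by rewrite -(dvdz_pcharf pF).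
    by rewrite scale0r subr0.
  by rewrite Er /toF rmorphM dvdp_mull.
have /eqP/polyP/(_ j) : toF g == 0.
  apply: contraLR f_g => g_neq0; apply/negP => /(dvdp_leq g_neq0).
  rewrite toFf size_XnsubC // leqNgt ltnS => /negP; apply.
  exact: leq_trans (size_poly _ _) sg.
by rewrite coef_map coef0 (dvdz_pcharf pF) => /= ->.
Qed.

End Radical.

End IntegersOfNumberField.

Theorem theorem1 (n : nat) (m : int) (K : fieldExtType rat) (theta : K)
    (n_gt2 : (2 < n)%N)
    (m_neq0 : m <> 0) (m_neq1 : m <> 1) (m_neqN1 : m <> -1)
    (m_sqfree : squarefree_int m)
    (theta_root : theta ^+ n = m%:~R)
    (K_gen : <<1; theta>>%VS = fullv)
    (not_power_basis : ~ integral_basis [tuple theta ^+ i | i < n])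
    (k : nat) (b : k.-tuple K) (b_basis : integral_basis b)
    (alpha : K) (alpha_in_b : alpha \in b)
    (a : 'I_n -> int) (q : int) (q_gt0 : 0 < q)
    (gcd_aq : \big[gcdz/q]_(i < n) a i = 1)
    (alphaE : alpha = (\sum_(i < n) (a i)%:~R * theta ^+ i) / q%:~R) :
  forall p : nat, prime p -> (p%:Z %| q)%Z -> (p %| n)%N /\ ~ (p%:Z %| m)%Z.
Proof.
move=> p p_pr pq.
have n_gt0 : (0 < n)%N by exact: leq_trans n_gt2.
have sqf (l : nat) : prime l -> ~~ ((l : int) ^+ 2 %| m)%Z.
  move=> l_pr; apply/negP => /m_sqfree.
  by rewrite qualifE /= orbF; case: l l_pr => [|[]].
pose g := \poly_(i < n) (if insub i is Some j then a j else 0).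
have g_coef (i : 'I_n) : g`_i = a i by rewrite coef_poly ltn_ord valK.
have sg : (size g <= n)%N by exact: size_poly.
have g_ndvd : ~ (forall j, (p %| g`_j)%Z).
  move=> p_g; have := dvdz_big_gcdz n a p q pq.
  rewrite gcd_aq dvdzE Euclid_dvd1 // => contra.
  by suff: false by []; apply: contra => i; rewrite -g_coef.
have g_pO : in_pO K p (map_poly intr g).[theta].
  have [c Eq] := dvdzP pq.
  (* Since [q = c * p], [p * (c * alpha) = q * alpha], the numerator of [alpha]. *)
  exists (c%:~R * alpha).
    apply: (integral_mul (RtoK := intr)); first exact: integral_intr.
    by have [b_int _ _] := b_basis;
      case/tnthP: alpha_in_b => i ->; apply: b_int.
  have q_neq0 : q%:~R != 0 :> K.
    by rewrite fieldExt_intr_eq0 Order.POrderTheory.gt_eqF.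
  rewrite mulrA -rmorphM /= [p%:Z * c]mulrC -Eq alphaE mulrC divfK //.
  rewrite (@horner_coef_wide _ n) ?(leq_trans (size_poly _ _)) //.
  by apply: eq_bigr => i _; rewrite coef_map /= g_coef.
have pm : ~~ (p %| m)%Z.
  apply/negP => pm; apply: g_ndvd.
  by apply: (eisenstein_coef_dvd K n m theta) => //; apply: sqf.
split; last exact/negP.
apply/negPn/negP => pn; apply: g_ndvd.
apply: (unramified_coef_dvd K n m theta) => // h sh h0.
(* Here [p] does not divide [m], so independence is taken from another prime, a factor of [m]. *)
have m_gt1 : (1 < `|m|)%N.
  by case: (m) m_neq0 m_neq1 m_neqN1 => [[|[|]]|[|]].
have l_pr := pdiv_prime m_gt1.
apply: (eisenstein_linear_independence K n m theta _ _ (pdiv `|m|)) => //.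
  by rewrite dvdzE absz_nat pdiv_dvd.
exact: sqf.
Qed.
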